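(* Let $F\in\ell^2(\mathbb Z)$ be supported in $[0,\infty)$. Define $(a_0,b_0)=(1+|F_0|^2)^{-1/2}(1,F_0)$ and, for $k>0$, $(a_k(z),b_k(z))=(a_{k-1}(z),b_{k-1}(z))\,(1+|F_k|^2)^{-1/2}(1,F_kz^k)$. Then $(a_k,b_k)$ converges in $(\mathbf L,\rho)$ to an element $(a,b)\in\overline{\mathbf H}$, and $$a(\infty)=\prod_{n\ge0}(1+|F_n|^2)^{-1/2}.$$
   Context: $\mathbb T$ is the unit circle, $\mathbb D$ the open unit disc, $\mathbb D^*=\{\overline z^{-1}:z\in\mathbb D\}$, $a^*(z)=\overline{a(\overline z^{-1})}$ (so $a^*=\overline a$ on $\mathbb T$), $\int_{\mathbb T}a=\int_0^1a(e^{2\pi i\theta})d\theta$. $H^2(\mathbb D)$ is the space of $f\in L^2(\mathbb T)$ with vanishing negative Fourier coefficients; $H^2(\mathbb D^* )$ the space of $f$ with $f^*\in H^2(\mathbb D)$; for such $f$, $f(\infty):=\overline{f^*(0)}=\int_{\mathbb T}f$. Pairs multiply as $(a,b)(c,d)=(ac-bd^*,ad+bc^* )$, where a constant $y$ satisfies $y^*=\overline y$ and $z\mapsto z^k$ satisfies $(z^k)^*=z^{-k}$. $\mathbf L$ is the set of pairs $(a,b)$ of measurable functions on $\mathbb T$ with $aa^*+bb^*=1$ a.e., $a\in H^2(\mathbb D^* )$, $a(\infty)>0$, with metric $\rho((a,b),(c,d))=\|a-c\|_{L^2(\mathbb T)}+\|b-d\|_{L^2(\mathbb T)}+|\log a(\infty)-\log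 c(\infty)|$. $\overline{\mathbf H}$ is the set of $(a,b)\in\mathbf L$ with $b\in H^2(\mathbb D)$. *)

(* Defs.v *)
(* R : realType, complex numbers R[i] (mathcomp-real-closed). *)
From mathcomp Require Import all_boot all_algebra.
From mathcomp Require Import all_classical all_reals all_analysis.
From mathcomp Require Export complex.
Export GRing.Theory Num.Theory.

Set Implicit Arguments.
Unset Strict Implicit.
Unset Printing Implicit Defensive.

Local Open Scope classical_set_scope.
Local Open Scope ring_scope.

Section Defs.
Variable R : realType.

(* A function on the unit circle T is represented by its boundary values
   theta |-> f(e^{2 pi i theta}), theta in [0,1]; so int_T f = int_0^1 f. *)
Definition Tdom : set R := `[0%R, 1%R].
Definition muT := (@lebesgue_measure R).

(* |z|^2 for z : R[i] *)
Definition csqnorm (z : R[i]) : R := (complex.Re z) ^+ 2 + (complex.Im z) ^+ 2.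

(* e^{i x} *)
Definition expi (x : R) : R[i] := (cos x +i* sin x)%C.

(* the function z |-> z^k on T, in the variable theta *)
Definition zpow (k : int) (t : R) : R[i] := expi (2 * pi * k%:~R * t).

(* measurable complex-valued function on T *)
Definition cmeasurable (f : R -> R[i]) : Prop :=
  measurable_fun Tdom (fun t => complex.Re (f t)) /\ measurable_fun Tdom (fun t => complex.Im (f t)).

(* f in L^2(T) *)
Definition inL2 (f : R -> R[i]) : Prop :=
  cmeasurable f /\ muT.-integrable Tdom (fun t => (csqnorm (f t))%:E).

(* ||f||_{L^2(T)} *)
Definition L2norm (f : R -> R[i]) : R :=
  Num.sqrt (Rintegral muT Tdom (fun t => csqnorm (f t))).

(* int_T f (real and imaginary parts integrated separately) *)
Definition cintT (f : R -> R[i]) : R[i] :=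
  (Rintegral muT Tdom (fun t => complex.Re (f t)) +i* Rintegral muT Tdom (fun t => complex.Im (f t)))%C.

(* k-th Fourier coefficient  int_T f(z) z^{-k} *)
Definition fourier (f : R -> R[i]) (k : int) : R[i] :=
  cintT (fun t => f t * zpow (- k) t).

(* H^2(D): L^2 functions with vanishing negative Fourier coefficients *)
Definition H2D (f : R -> R[i]) : Prop :=
  inL2 f /\ forall k : int, (k < 0)%R -> fourier f k = 0.

(* H^2(D-star): f-star in H^2(D), i.e. vanishing positive Fourier coefficients *)
Definition H2Dstar (f : R -> R[i]) : Prop :=
  inL2 f /\ forall k : int, (0 < k)%R -> fourier f k = 0.

(* f(infty) := int_T f for f in H^2(D-star) *)
Definition at_infty (f : R -> R[i]) : R[i] := cintT f.

(* the space L: a a-star + b b-star = 1 a.e. on T (a-star = conj a on T),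
   a in H^2(D-star), a(infty) > 0 *)
Definition inL (a b : R -> R[i]) : Prop :=
  [/\ cmeasurable a, cmeasurable b,
      {ae muT, forall t, Tdom t -> a t * (a t)^* + b t * (b t)^* = 1},
      H2Dstar a & 0 < at_infty a].

(* the closure \overline{H}: additionally b in H^2(D) *)
Definition inHbar (a b : R -> R[i]) : Prop := inL a b /\ H2D b.

(* the metric rho *)
Definition rho (a b c d : R -> R[i]) : R :=
  L2norm (fun t => a t - c t) + L2norm (fun t => b t - d t)
  + `| ln (complex.Re (at_infty a)) - ln (complex.Re (at_infty c)) |.

(* product of pairs (a,b)(c,d) = (a c - b d-star, a d + b c-star), with g-star = conj g on T *)
Definition pmul (p q : (R -> R[i]) * (R -> R[i])) : (R -> R[i]) * (R -> R[i]) :=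
  (fun t => p.1 t * q.1 t - p.2 t * (q.2 t)^*,
   fun t => p.1 t * q.2 t + p.2 t * (q.1 t)^*).

(* (1 + |F_k|^2)^{-1/2} *)
Definition sfac (F : int -> R[i]) (k : nat) : R :=
  (Num.sqrt (1 + csqnorm (F k%:Z)))^-1.

(* the sequence (a_k, b_k) *)
Fixpoint abseq (F : int -> R[i]) (k : nat) : (R -> R[i]) * (R -> R[i]) :=
  match k with
  | 0%N => (fun _ => (sfac F 0)%:C%C, fun _ => (sfac F 0)%:C%C * F 0)
  | k'.+1 => pmul (abseq F k')
               (fun _ => (sfac F k)%:C%C,
                fun t => (sfac F k)%:C%C * (F k%:Z * zpow k%:Z t))
  end.

End Defs.

(* Main.v *)
(* The pair (a, b) stands for the matrix [[a, b], [- b-star, a-star]], which is in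
   SU(2) on T when a a-star + b b-star = 1.  For m <= n the partial products thus
   satisfy (a_n, b_n) = (a_m, b_m)(c, d), with (c, d) the product of the factors of
   index m + 1, ..., n, and pointwise
     |a_n - a_m|^2 + |b_n - b_m|^2 = |c - 1|^2 + |d|^2 = 2 - 2 Re c.
   The mean of c is the product of the (1 + |F_k|^2)^(-1/2), m < k <= n.  Since F is
   square summable the infinite product of these factors is positive, so the right
   hand side has a small integral and (a_k, b_k) is Cauchy in L^2.  The frequency
   supports, the identity |a|^2 + |b|^2 = 1 and the value at infinity pass to the
   limit. *)
Require Import Defs.
From mathcomp Require Import all_boot all_order all_algebra.
From mathcomp Require Import all_classical all_reals all_analysis.
From mathcomp Require Import measurable_realfun complex.
From mathcomp Require Import ring lra zify.
Import Order.TTheory GRing.Theory Num.Theory numFieldNormedType.Exports.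
Local Open Scope classical_set_scope.
Local Open Scope ring_scope.

Set Implicit Arguments.
Unset Strict Implicit.
Unset Printing Implicit Defensive.

(** * Integration of bounded measurable functions over one period *)

Section BoundedMeasurable.
Variable R : realType.
Implicit Types (u v : R -> R).

Notation I := (Rintegral (@muT R) (@Tdom R)).

(** The bound holds at every point, not just almost everywhere, so the class is stable under sums
    and products with no side conditions. Integrability follows from the finite measure of the
    interval. *)
Definition bmeas u := measurable_fun (@Tdom R) u /\ exists M : R, forall t, `|u t| <= M.

Lemma measurable_Tdom : measurable (@Tdom R).
Proof. exact: measurable_itv. Qed.

Lemma muT_Tdom : @muT R (@Tdom R) = 1%E.
Proof. by rewrite /muT /Tdom lebesgue_measure_itv /= lte_fin ltr01 oppr0 adde0. Qed.

Lemma bmeas_cst (c : R) : bmeas (fun=> c).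
Proof. by split; [exact: measurable_cst | exists `|c|]. Qed.

Lemma bmeasD u v : bmeas u -> bmeas v -> bmeas (fun t => u t + v t).
Proof.
move=> [mu [M uM]] [mv [N vN]]; split; first exact: measurable_funD.
by exists (M + N) => t; rewrite (le_trans (ler_normD _ _))// lerD.
Qed.

Lemma bmeasM u v : bmeas u -> bmeas v -> bmeas (fun t => u t * v t).
Proof.
move=> [mu [M uM]] [mv [N vN]]; split; first exact: measurable_funM.
by exists (M * N) => t; rewrite normrM ler_pM.
Qed.

Lemma bmeasN u : bmeas u -> bmeas (fun t => - u t).
Proof.
move=> [mu [M uM]]; split; first exact: measurableT_comp.
by exists M => t; rewrite normrN.
Qed.

Lemma bmeasB u v : bmeas u -> bmeas v -> bmeas (fun t => u t - v t).
Proof. by move=> bu bv; apply: bmeasD => //; exact: bmeasN. Qed.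

Lemma bmeasX u n : bmeas u -> bmeas (fun t => u t ^+ n).
Proof.
move=> bu; elim: n => [|n IHn]; first exact: bmeas_cst.
by under eq_fun do rewrite exprS; exact: bmeasM.
Qed.

Lemma bmeas_norm u : bmeas u -> bmeas (fun t => `|u t|).
Proof.
move=> [mu [M uM]]; split; first exact: measurableT_comp.
by exists M => t; rewrite normr_id.
Qed.

Lemma bmeas_integrable u : bmeas u -> (@muT R).-integrable (@Tdom R) (EFin \o u).
Proof.
move=> [mu [M uM]]; apply: measurable_bounded_integrable => //.
- exact: measurable_Tdom.
- by rewrite [X in (X < _)%E]muT_Tdom ltry.
- exists M; split; first by rewrite num_real.
  by move=> x Mx t _ /=; exact: le_trans (uM t) (ltW Mx).
Qed.

Lemma intD u v : bmeas u -> bmeas v -> I (fun t => u t + v t) = I u + I v.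
Proof.
move=> /bmeas_integrable iu /bmeas_integrable iv.
by apply: RintegralD => //; exact: measurable_Tdom.
Qed.

Lemma intB u v : bmeas u -> bmeas v -> I (fun t => u t - v t) = I u - I v.
Proof.
move=> /bmeas_integrable iu /bmeas_integrable iv.
by apply: RintegralB => //; exact: measurable_Tdom.
Qed.

Lemma intZ (c : R) u : bmeas u -> I (fun t => c * u t) = c * I u.
Proof.
by move=> /bmeas_integrable iu; apply: RintegralZl => //; exact: measurable_Tdom.
Qed.

Lemma int_cst (c : R) : I (fun=> c) = c.
Proof.
rewrite /Rintegral/= integral_cst/=; last exact: measurable_Tdom.
by rewrite [X in (_ * X)%E]muT_Tdom mule1.
Qed.

Lemma le_int u v : bmeas u -> bmeas v -> (forall t, u t <= v t) -> I u <= I v.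
Proof.
move=> /bmeas_integrable iu /bmeas_integrable iv uv.
by apply: le_Rintegral => //; exact: measurable_Tdom.
Qed.

Lemma int_ge0 u : (forall t, 0 <= u t) -> 0 <= I u.
Proof. by move=> u0; exact: Rintegral_ge0. Qed.

Lemma le_norm_int u : bmeas u -> `|I u| <= I (fun t => `|u t|).
Proof.
by move=> /bmeas_integrable iu; apply: le_normr_Rintegral => //; exact: measurable_Tdom.
Qed.

Lemma integral_EFin u : bmeas u ->
  (\int[@muT R]_(t in @Tdom R) (u t)%:E)%E = (I u)%:E.
Proof.
move=> /bmeas_integrable iu; rewrite /Rintegral fineK//.
by apply: integrable_fin_num => //; exact: measurable_Tdom.
Qed.

(** * Mean values of cosines and sines of integer frequency *)

Lemma sin_2pik (k : int) : sin (2 * pi * k%:~R) = 0 :> R.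
Proof.
have E n : sin (2 * pi * n%:R) = 0 :> R.
  have -> : 2 * pi * n%:R = 0 + pi *+ 2 *+ n :> R by rewrite add0r mulr_natr mulr_natl.
  by rewrite (periodicn (@sinD2pi R)) sin0.
case: k => n; first exact: E.
by rewrite NegzE mulrNz mulrN sinN E oppr0.
Qed.

Lemma cos_2pik (k : int) : cos (2 * pi * k%:~R) = 1 :> R.
Proof.
have E n : cos (2 * pi * n%:R) = 1 :> R.
  have -> : 2 * pi * n%:R = 0 + pi *+ 2 *+ n :> R by rewrite add0r mulr_natr mulr_natl.
  by rewrite (periodicn (@cosD2pi R)) cos0.
case: k => n; first exact: E.
by rewrite NegzE mulrNz mulrN cosN E.
Qed.

Lemma int_derive (F f : R -> R) : (forall x : R, is_derive x (1 : R) F (f x)) ->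
  continuous f -> I f = F 1 - F 0.
Proof.
move=> dF cf.
have cF : continuous F.
  by move=> x; apply: differentiable_continuous; apply/derivable1_diffP; have [] := dF x.
rewrite /Rintegral (@continuous_FTC2 _ _ F)//.
- exact: continuous_subspaceT.
- split.
  + by move=> x _; have [] := dF x.
  + by apply: cvg_at_right_filter; exact: cF.
  + by apply: cvg_at_left_filter; exact: cF.
- by move=> x _; rewrite derive1E; have [] := dF x.
Qed.

Lemma continuous_scale (c : R) : continuous (fun t : R => c * t).
Proof. by move=> x; apply: continuousM; [exact: cvg_cst|exact: cvg_id]. Qed.

Lemma int_cos (k : int) : k != 0 -> I (fun t => cos (2 * pi * k%:~R * t)) = 0.
Proof.
move=> k0; set c := 2 * pi * k%:~R.
have c0 : c != 0 by rewrite !mulf_neq0 ?pnatr_eq0 ?intr_eq0// gt_eqF// pi_gt0.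
have dF (x : R) : is_derive x (1 : R) (fun t : R => c^-1 * sin (c * t)) (cos (c * x)).
  by apply: is_derive_eq; rewrite /GRing.scale/=; field.
rewrite (int_derive dF); first by rewrite mulr0 sin0 mulr0 mulr1 /c sin_2pik mulr0 subrr.
by move=> x; apply: continuous_comp; [exact: continuous_scale|exact: continuous_cos].
Qed.

Lemma int_sin (k : int) : I (fun t => sin (2 * pi * k%:~R * t)) = 0.
Proof.
have [->|k0] := eqVneq k 0.
  by under eq_fun do rewrite mulr0 mul0r sin0; exact: int_cst.
set c := 2 * pi * k%:~R.
have c0 : c != 0 by rewrite !mulf_neq0 ?pnatr_eq0 ?intr_eq0// gt_eqF// pi_gt0.
have dF (x : R) : is_derive x (1 : R) (fun t : R => - c^-1 * cos (c * t)) (sin (c * x)).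
  by apply: is_derive_eq; rewrite /GRing.scale/=; field.
rewrite (int_derive dF); first by rewrite mulr0 cos0 mulr1 /c cos_2pik subrr.
by move=> x; apply: continuous_comp; [exact: continuous_scale|exact: continuous_sin].
Qed.

End BoundedMeasurable.

(** * Limits of uniformly bounded Cauchy sequences in L^1 *)

Section Completeness.
Variable R : realType.

Notation I := (Rintegral (@muT R) (@Tdom R)).

(** Absolute convergence of the telescoping series, whose partial sums are [w n - w 0]. *)
Lemma summable_increments_cvg (w : nat -> R) :
  (\sum_(0 <= k <oo) (`|w k.+1 - w k|)%:E < +oo)%E -> cvgn w.
Proof.
move=> sfin.
have s_fin : (\sum_(0 <= k <oo) (`|w k.+1 - w k|)%:E)%E \is a fin_num.
  by rewrite ge0_fin_numE//; apply: nneseries_ge0 => n _ _; rewrite lee_fin.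
have : cvgn [normed series (telescope w)].
  apply: nondecreasing_is_cvgn.
    by apply/nondecreasing_seqP => n; rewrite /= seriesSr lerDl.
  exists (fine (\sum_(0 <= k <oo) (`|w k.+1 - w k|)%:E)%E) => _ [n _ <-].
  rewrite -lee_fin fineK// /series/= -sumEFin.
  by apply: nneseries_lim_ge => k _ _; rewrite lee_fin.
move=> /normed_cvg; rewrite telescopeK => cw.
rewrite (_ : w = (fun n => (w n - w 0%N) + w 0%N)); last first.
  by apply/funext => n; rewrite subrK.
by apply: is_cvgD => //; exact: is_cvg_cst.
Qed.

Lemma ae_muTS (P Q : R -> Prop) : (forall t, P t -> Q t) ->
  {ae @muT R, forall t, P t} -> {ae @muT R, forall t, Q t}.
Proof.
move=> PQ aeP.
exact: (@filterS _ _ (ae_filter_ringOfSetsType (@lebesgue_measure R)) _ _ PQ aeP).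
Qed.

Lemma ae_muTW (P : R -> Prop) : (forall t, P t) -> {ae @muT R, forall t, P t}.
Proof.
move=> PT.
exact: (@nearW _ _ _ (ae_filter_ringOfSetsType (@lebesgue_measure R)) PT).
Qed.

(* Along a subsequence with summable L^1 increments the functions converge
   almost everywhere; the clipped limit superior of that subsequence is a
   measurable limit, and dominated convergence controls the distance to it. *)
Lemma bounded_L1_complete (u : nat -> R -> R) :
  (forall n, measurable_fun (@Tdom R) (u n)) -> (forall n t, `|u n t| <= 1) ->
  (forall e : R, 0 < e -> exists N, forall m n, (N <= m)%N -> (N <= n)%N ->
     I (fun t => `|u m t - u n t|) <= e) ->
  exists v : R -> R, [/\ measurable_fun (@Tdom R) v, forall t, `|v t| <= 1 &
    I (fun t => `|u n t - v t|) @[n --> \oo] --> 0].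
Proof.
move=> mu u1 cau.
have bu n : bmeas (u n) by split => //; exists 1.
have bd (f g : R -> R) : bmeas f -> bmeas g -> bmeas (fun t => `|f t - g t|).
  by move=> bf bg; apply: bmeas_norm; exact: bmeasB.
(* These tolerances add up to 1, the bound claimed in [wint]. *)
have e0 k : 0 < 1 / (2 ^ k.+1)%:R :> R by rewrite divr_gt0// ltr0n expn_gt0.
pose N k := projT1 (cid (cau _ (e0 k))).
have NP k m n : (N k <= m)%N -> (N k <= n)%N ->
    I (fun t => `|u m t - u n t|) <= 1 / (2 ^ k.+1)%:R.
  by move: m n; rewrite /N; case: cid.
(* Adding up the thresholds makes [s] strictly increasing and keeps [s k] above [N k]. *)
pose s k := (\sum_(i < k.+1) (N i).+1)%N.
have sN k : (N k <= s k)%N by rewrite /s big_ord_recr/=; lia.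
have sS k : (s k < s k.+1)%N by rewrite [s k.+1]/s big_ord_recr/= -/(s k); lia.
have s_ge k : (k <= s k)%N by elim: k => // k IH; exact: leq_ltn_trans IH (sS k).
pose w k := u (s k).
have wint : (\int[@muT R]_(t in @Tdom R)
    \sum_(0 <= k <oo) (`|w k.+1 t - w k t|)%:E <= 1)%E.
  have mg k : measurable_fun (@Tdom R) (fun t => (`|w k.+1 t - w k t|)%:E).
    by apply/measurable_EFinP; case: (bd _ _ (bu (s k.+1)) (bu (s k))).
  have g0 k t : @Tdom R t -> (0 <= (`|w k.+1 t - w k t|)%:E)%E by rewrite lee_fin.
  rewrite (integral_nneseries (@muT R) (@measurable_Tdom R) mg g0).
  apply: (le_trans _ (epsilon_trick0 predT (ler01 : 0 <= 1 :> R))).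
  apply: lee_nneseries => [k _ _|k _]; first by apply: integral_ge0 => t _; rewrite lee_fin.
  rewrite (integral_EFin (bd _ _ (bu _) (bu _))) lee_fin.
  by apply: NP => //; exact: leq_trans (sN k) (ltnW (sS k)).
have wcvg : {ae @muT R, forall t, @Tdom R t -> cvgn (w ^~ t)}.
  have wi : (@muT R).-integrable (@Tdom R)
      (fun t => \sum_(0 <= k <oo) (`|w k.+1 t - w k t|)%:E)%E.
    apply/integrableP; split.
      apply: ge0_emeasurable_sum => k *; first by rewrite lee_fin.
      by apply/measurable_EFinP; case: (bd _ _ (bu (s k.+1)) (bu (s k))).
    under eq_integral.
      move=> t _; rewrite gee0_abs; last by apply: nneseries_ge0 => *; rewrite lee_fin.
      over.
    by apply: (le_lt_trans wint); rewrite ltry.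
  (* An integrable sum of increments is finite almost everywhere, and [w] converges wherever it is
     finite. *)
  have /(_ (@measurable_Tdom R)) := fun mD => integrable_ae mD wi.
  apply: ae_muTS => t wt /wt.
  rewrite fin_numE => /andP[_ h]; apply: summable_increments_cvg.
  by rewrite ltey.
(* Clipping to [-1, 1] removes infinite values, so [fine] never meets its default case and the bound
   on [v] holds everywhere. Where [w] converges, its limit already lies in [-1, 1] and is left
   unchanged. *)
pose v t := fine (maxe (-1)%:E (mine 1%:E (limn_esup (fun k => (w k t)%:E)))).
have v1 t : `|v t| <= 1.
  rewrite /v; set y := maxe _ _.
  have : ((-1)%:E <= y <= 1%:E)%E.
    rewrite /y le_max lexx /= ge_max ge_min lexx /= andbT.
    by rewrite lee_fin; lra.
  by case: y => [r| |]; rewrite ?leye_eq ?leeNy_eq ?andbF//= ler_norml.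
have mv : measurable_fun (@Tdom R) v.
  apply: measurableT_comp => //.
  apply: measurable_maxe => //; apply: measurable_mine => //.
  by apply: measurable_fun_limn_esup => k; apply/measurable_EFinP; exact: mu.
have bv : bmeas v by split => //; exists 1.
have wv : {ae @muT R, forall t, @Tdom R t -> w k t @[k --> \oo] --> v t}.
  move: wcvg; apply: ae_muTS => t wt /wt {}wt.
  suff -> : v t = limn (w ^~ t) by [].
  have l1 : limn (w ^~ t) <= 1.
    by apply: limr_le => //; apply: nearW => k; have := u1 (s k) t; rewrite ler_norml => /andP[].
  have l2 : -1 <= limn (w ^~ t).
    by apply: limr_ge => //; apply: nearW => k; have := u1 (s k) t; rewrite ler_norml => /andP[].
  have lE : (w k t)%:E @[k --> \oo] --> (limn (w ^~ t))%:E
    by apply: cvg_EFin; [exact: nearW|exact: wt].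
  rewrite /v is_cvg_limn_esupE; last first.
    by apply: cvgP lE.
  rewrite (cvg_lim _ lE)// -EFin_min -EFin_max/=.
  by rewrite (min_idPr l1) (max_idPr l2).
exists v; split => //.
apply/cvgr0Pnorm_le => e e_gt0; have [n0 n0P] := cau _ e_gt0.
near=> n.
rewrite ger0_norm; last exact: int_ge0.
rewrite -lee_fin -(integral_EFin (bd _ _ (bu n) bv)).
(* Here [n] is fixed and [k] tends to infinity: the integral of |u_n - v| is the limit of the
   integrals of |u_n - w_k|, which are at most [e] once [k >= n0], because [s k >= k]. *)
have [|||||_ _ dom] := @dominated_convergence _ _ _ (@muT R) (@Tdom R) (@measurable_Tdom R)
  (fun k t => (`|u n t - w k t|)%:E) (fun t => (`|u n t - v t|)%:E) (cst 2%:E).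
- by move=> k; apply/measurable_EFinP; case: (bd _ _ (bu n) (bu (s k))).
- by apply/measurable_EFinP; case: (bd _ _ (bu n) bv).
- move: wv; apply: ae_muTS => t wt /wt {}wt.
  apply: cvg_EFin; first exact: nearW.
  by apply: cvg_norm; apply: cvgB => //; exact: cvg_cst.
- exact: (bmeas_integrable (bmeas_cst 2)).
- apply: nearW => t k _ /=; rewrite lee_fin normr_id (le_trans (ler_normB _ _))//.
  by have := u1 n t; have := u1 (s k) t; rewrite -/(w k); lra.
apply: cvge_le dom.
exists n0 => // k /= n0k.
rewrite (integral_EFin (bd _ _ (bu n) (bu (s k)))) lee_fin.
apply: n0P; last exact: leq_trans n0k (s_ge k).
by near: n; exists n0.
Unshelve. all: by end_near.
Qed.

End Completeness.

(** * Complex functions on the circle and their Fourier coefficients *)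

Section ComplexFunctions.
Variable R : realType.
Implicit Types (f g : R -> R[i]) (a b c d : R[i]) (j k : int) (t : R).

Notation I := (Rintegral (@muT R) (@Tdom R)).

Lemma csqnorm_conj a : (csqnorm a)%:C%C = a * a^*.
Proof.
case: a => x y; apply/eqP; rewrite eq_complex /csqnorm/=.
by apply/andP; split; apply/eqP; ring.
Qed.

Lemma csqnormM a b : csqnorm (a * b) = csqnorm a * csqnorm b.
Proof. by case: a b => [x y] [x' y']; rewrite /csqnorm/=; ring. Qed.

Lemma csqnorm_ge0 a : 0 <= csqnorm a.
Proof. by rewrite /csqnorm addr_ge0// sqr_ge0. Qed.

Lemma csqnorm_real (x : R) : csqnorm x%:C%C = x ^+ 2.
Proof. by rewrite /csqnorm/= expr0n addr0. Qed.

Lemma zpow0 t : zpow 0 t = 1 :> R[i].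
Proof. by rewrite /zpow mulr0 mul0r /expi cos0 sin0. Qed.

Lemma zpowD j k t : zpow (j + k) t = zpow j t * zpow k t :> R[i].
Proof.
rewrite /zpow intrD mulrDr mulrDl /expi cosD sinD.
by apply/eqP; rewrite eq_complex /=; apply/andP; split; apply/eqP; ring.
Qed.

Lemma conj_zpow k t : (zpow k t)^* = zpow (- k) t :> R[i].
Proof. by rewrite /zpow /expi intrN mulrN mulNr cosN sinN. Qed.

Lemma csqnorm_zpow k t : csqnorm (zpow k t : R[i]) = 1.
Proof. by rewrite /csqnorm/= cos2Dsin2. Qed.

Definition cbmeas f := bmeas (fun t => complex.Re (f t)) /\ bmeas (fun t => complex.Im (f t)).

Lemma cbmeas_cst c : cbmeas (fun=> c).
Proof. by split; exact: bmeas_cst. Qed.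

Lemma cbmeasD f g : cbmeas f -> cbmeas g -> cbmeas (fun t => f t + g t).
Proof.
move=> [fr fi] [gr gi]; split.
  by under eq_fun do rewrite raddfD; exact: bmeasD.
by under eq_fun do rewrite raddfD; exact: bmeasD.
Qed.

Lemma cbmeasB f g : cbmeas f -> cbmeas g -> cbmeas (fun t => f t - g t).
Proof.
move=> [fr fi] [gr gi]; split.
  by under eq_fun do rewrite raddfB; exact: bmeasB.
by under eq_fun do rewrite raddfB; exact: bmeasB.
Qed.

Lemma complex_ReM a b : complex.Re (a * b) =
  complex.Re a * complex.Re b - complex.Im a * complex.Im b.
Proof. by case: a b => [x y] [x' y']. Qed.

Lemma complex_ImM a b : complex.Im (a * b) =
  complex.Re a * complex.Im b + complex.Im a * complex.Re b.
Proof. by case: a b => [x y] [x' y']. Qed.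

Lemma cbmeasM f g : cbmeas f -> cbmeas g -> cbmeas (fun t => f t * g t).
Proof.
move=> [fr fi] [gr gi]; split.
  by under eq_fun do rewrite complex_ReM; apply: bmeasB; exact: bmeasM.
by under eq_fun do rewrite complex_ImM; apply: bmeasD; exact: bmeasM.
Qed.

Lemma cbmeas_zpow k : cbmeas (fun t => zpow k t : R[i]).
Proof.
split; split.
- apply: measurable_funTS; apply: continuous_measurable_fun => x.
  by apply: continuous_comp; [exact: continuous_scale|exact: continuous_cos].
- by exists 1 => t; rewrite ler_norml cos_geN1 cos_le1.
- apply: measurable_funTS; apply: continuous_measurable_fun => x.
  by apply: continuous_comp; [exact: continuous_scale|exact: continuous_sin].
- by exists 1 => t; rewrite ler_norml sin_geN1 sin_le1.
Qed.

Lemma cbmeas_cmeasurable f : cbmeas f -> cmeasurable f.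
Proof. by move=> [[mr _] [mi _]]. Qed.

Lemma bmeas_csqnorm f : cbmeas f -> bmeas (fun t => csqnorm (f t)).
Proof. by move=> [fr fi]; apply: bmeasD; exact: bmeasX. Qed.

Lemma cbmeas_inL2 f : cbmeas f -> inL2 f.
Proof.
move=> bf; split; first exact: cbmeas_cmeasurable.
exact: bmeas_integrable (bmeas_csqnorm bf).
Qed.

Lemma cintTD f g : cbmeas f -> cbmeas g ->
  cintT (fun t => f t + g t) = cintT f + cintT g.
Proof.
move=> [fr fi] [gr gi]; rewrite /cintT.
under [in LHS]eq_fun do rewrite raddfD.
under [X in (_ +i* Rintegral _ _ X)%C]eq_fun do rewrite raddfD.
by rewrite !intD.
Qed.

Lemma cintTZ c f : cbmeas f -> cintT (fun t => c * f t) = c * cintT f.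
Proof.
move=> [fr fi]; rewrite /cintT.
under [in LHS]eq_fun do rewrite complex_ReM.
under [X in (_ +i* Rintegral _ _ X)%C]eq_fun do rewrite complex_ImM.
have bz (x : R) u : bmeas u -> bmeas (fun t => x * u t).
  by move=> bu; apply: bmeasM => //; exact: bmeas_cst.
rewrite intB; [|exact: bz|exact: bz].
rewrite intD; [|exact: bz|exact: bz].
by rewrite !intZ//; case: c.
Qed.

Lemma fourierD f g k : cbmeas f -> cbmeas g ->
  fourier (fun t => f t + g t) k = fourier f k + fourier g k.
Proof.
move=> bf bg; rewrite /fourier -cintTD; last 2 first.
- by apply: cbmeasM => //; exact: cbmeas_zpow.
- by apply: cbmeasM => //; exact: cbmeas_zpow.
by congr cintT; apply/funext => t; rewrite mulrDl.
Qed.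

Lemma fourier_mul_zpow f c j k : cbmeas f ->
  fourier (fun t => f t * (c * zpow j t)) k = c * fourier f (k - j).
Proof.
move=> bf; rewrite /fourier -cintTZ; last by apply: cbmeasM => //; exact: cbmeas_zpow.
by congr cintT; apply/funext => t; rewrite opprB (addrC j) zpowD; ring.
Qed.

Lemma fourierZ f c k : cbmeas f -> fourier (fun t => f t * c) k = c * fourier f k.
Proof.
move=> bf; rewrite -[k in RHS]subr0 -fourier_mul_zpow//; congr fourier.
by apply/funext => t; rewrite zpow0 mulr1.
Qed.

Lemma fourier0 k : fourier (fun=> 0 : R[i]) k = 0.
Proof.
have := @fourierZ (fun=> 0) 0 k (cbmeas_cst 0).
by rewrite [RHS]mul0r => E; rewrite -[RHS]E; congr fourier; apply/funext => t; rewrite mulr0.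
Qed.

Lemma fourier1 k : fourier (fun=> 1 : R[i]) k = (k == 0)%:R.
Proof.
rewrite /fourier; have [->|k0] := eqVneq.
  under eq_fun do rewrite oppr0 zpow0 mulr1.
  by rewrite /cintT !int_cst.
under eq_fun do rewrite mul1r.
by rewrite /cintT /zpow/= int_cos ?oppr_eq0// int_sin.
Qed.

Lemma at_infty_fourier f : at_infty f = fourier f 0.
Proof.
by rewrite /at_infty /fourier; congr cintT; apply/funext => t; rewrite oppr0 zpow0 mulr1.
Qed.

End ComplexFunctions.

(** * Products of consecutive factors, their frequencies and their distances *)

Section PartialProducts.
Variables (R : realType) (F : int -> R[i]).
Implicit Types (p q r : (R -> R[i]) * (R -> R[i])) (m n : nat) (k : int) (t : R).

Notation I := (Rintegral (@muT R) (@Tdom R)).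

Definition factor n : (R -> R[i]) * (R -> R[i]) :=
  (fun=> (sfac F n)%:C%C, fun t => (sfac F n)%:C%C * (F n%:Z * zpow n%:Z t)).

(** The factors of index [m], ..., [m + n - 1], multiplied onto the identity matrix [(1, 0)]. A free
    starting index lets the same object describe the tails. *)
Fixpoint partial m n : (R -> R[i]) * (R -> R[i]) :=
  if n is n'.+1 then pmul (partial m n') (factor (m + n')) else (fun=> 1, fun=> 0).

(** The determinant of the matrix attached to [p], hence multiplicative. *)
Definition pnorm p t : R := csqnorm (p.1 t) + csqnorm (p.2 t).

(** The shift arises because [abseq F 0] already contains the factor of index 0, whereas
    [partial 0 0] is the identity. *)
Lemma abseq_partial n : abseq F n = partial 0 n.+1.
Proof.
elim: n => [|n IHn]; last by rewrite [LHS]/= IHn.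
rewrite /= /pmul /factor/=; congr pair; apply/funext => t.
  by rewrite mul0r subr0 mul1r.
by rewrite zpow0 mulr1 mul0r addr0 mul1r.
Qed.

Lemma complex_ext (z w : R[i]) :
  complex.Re z = complex.Re w -> complex.Im z = complex.Im w -> z = w.
Proof. by case: z w => [x y] [x' y'] /= -> ->. Qed.

Lemma pmulA p q r : pmul p (pmul q r) = pmul (pmul p q) r.
Proof.
congr pair; apply/funext => t /=;
  case: (p.1 t) (p.2 t) (q.1 t) (q.2 t) (r.1 t) (r.2 t)
    => [x1 y1] [x2 y2] [x3 y3] [x4 y4] [x5 y5] [x6 y6];
  by apply: complex_ext => /=; ring.
Qed.

Lemma partial_cat m i j : partial m (i + j) = pmul (partial m i) (partial (m + i) j).
Proof.
elim: j => [|j IHj]; last by rewrite addnS/= IHj -pmulA addnA.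
rewrite addn0 /pmul/=; case: (partial m i) => a b; congr pair; apply/funext => t /=.
  by rewrite rmorph0 mulr1 mulr0 subr0.
by rewrite rmorph1 mulr1 mulr0 add0r.
Qed.

Lemma pnorm_pmul p q t : pnorm (pmul p q) t = pnorm p t * pnorm q t.
Proof.
rewrite /pnorm/pmul/=.
case: (p.1 t) (p.2 t) (q.1 t) (q.2 t) => [x1 y1] [x2 y2] [x3 y3] [x4 y4].
by rewrite /csqnorm/=; ring.
Qed.

Lemma sfac_gt0 n : 0 < sfac F n.
Proof. by rewrite /sfac invr_gt0 sqrtr_gt0 ltr_pwDl// csqnorm_ge0. Qed.

Lemma sfac_le1 n : sfac F n <= 1.
Proof.
rewrite /sfac invf_le1; last by rewrite sqrtr_gt0 ltr_pwDl// csqnorm_ge0.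
by rewrite -[leLHS]sqrtr1 ler_wsqrtr// lerDl csqnorm_ge0.
Qed.

Lemma pnorm_factor n t : pnorm (factor n) t = 1.
Proof.
rewrite /pnorm/= !csqnormM csqnorm_real csqnorm_zpow mulr1.
have D0 : 0 < 1 + csqnorm (F n) by rewrite ltr_pwDl// csqnorm_ge0.
rewrite /sfac exprVn sqr_sqrtr; last exact: ltW.
by rewrite -{1}[_^-1]mulr1 -mulrDr mulVf// gt_eqF.
Qed.

Lemma pnorm_partial m n t : pnorm (partial m n) t = 1.
Proof.
elim: n => [|n IHn]/=; first by rewrite /pnorm/csqnorm/=; ring.
by rewrite pnorm_pmul IHn pnorm_factor mulr1.
Qed.

Lemma csqnorm_partial m n t :
  csqnorm ((partial m n).1 t) <= 1 /\ csqnorm ((partial m n).2 t) <= 1.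
Proof.
by rewrite -(pnorm_partial m n t) /pnorm lerDl lerDr !csqnorm_ge0.
Qed.

(** Each term is brought to the form of an earlier component times a constant, or times a constant
    multiple of a power of z, as [fourierZ] and [fourier_mul_zpow] expect. Conjugation makes the
    exponent negative here. *)
Lemma partial1S m n : (partial m n.+1).1 = fun t =>
  (partial m n).1 t * (sfac F (m + n))%:C%C +
  (partial m n).2 t * (- (sfac F (m + n))%:C%C * (F (m + n)%N)^* * zpow (- (m + n)%:Z) t).
Proof.
apply/funext => t; rewrite -conj_zpow /=.
case: ((partial m n).1 t) ((partial m n).2 t) (F (m + n)%N) (zpow _ t)
  => [x1 y1] [x2 y2] [x3 y3] [x4 y4].
by apply: complex_ext => /=; ring.
Qed.

Lemma partial2S m n : (partial m n.+1).2 = fun t =>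
  (partial m n).1 t * ((sfac F (m + n))%:C%C * F (m + n)%N * zpow (m + n)%:Z t) +
  (partial m n).2 t * (sfac F (m + n))%:C%C.
Proof.
apply/funext => t /=.
case: ((partial m n).1 t) ((partial m n).2 t) (F (m + n)%N) (zpow _ t)
  => [x1 y1] [x2 y2] [x3 y3] [x4 y4].
by apply: complex_ext => /=; ring.
Qed.

Lemma cbmeas_partial m n : cbmeas (partial m n).1 /\ cbmeas (partial m n).2.
Proof.
elim: n => [|n [bc bd]]; first by split; exact: cbmeas_cst.
have bz c k : cbmeas (fun t => c * zpow k t : R[i]).
  by apply: cbmeasM; [exact: cbmeas_cst|exact: cbmeas_zpow].
rewrite partial1S partial2S; split; apply: cbmeasD; apply: cbmeasM => //; exact: cbmeas_cst.
Qed.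

(* The ranges of frequencies: [- n, 0] for the first component and
   [m, m + n - 1] for the second. *)
Lemma fourier_partial m n k :
  [/\ fourier (partial m n).1 0 = (\prod_(i < n) sfac F (m + i))%:C%C,
      (0 < k -> fourier (partial m n).1 k = 0),
      (k < - n%:Z -> fourier (partial m n).1 k = 0),
      (k < m%:Z -> fourier (partial m n).2 k = 0) &
      ((m + n)%:Z <= k -> fourier (partial m n).2 k = 0)].
Proof.
elim: n k => [|n IHn] k.
  rewrite /= !fourier1 fourier0 big_ord0 eqxx; split=> // k0.
    by rewrite gt_eqF.
  by rewrite lt_eqF// -oppr0.
have [bc bd] := cbmeas_partial m n.
have bz c j : cbmeas (fun t => c * zpow j t : R[i]).
  by apply: cbmeasM; [exact: cbmeas_cst|exact: cbmeas_zpow].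
have bs := cbmeas_cst (sfac F (m + n))%:C%C.
have E1 j : fourier (partial m n.+1).1 j = (sfac F (m + n))%:C%C * fourier (partial m n).1 j +
    - (sfac F (m + n))%:C%C * (F (m + n)%N)^* * fourier (partial m n).2 (j + (m + n)%:Z).
  rewrite partial1S fourierD ?fourierZ ?fourier_mul_zpow ?opprK//; exact: cbmeasM.
have E2 j : fourier (partial m n.+1).2 j =
    (sfac F (m + n))%:C%C * F (m + n)%N * fourier (partial m n).1 (j - (m + n)%:Z) +
    (sfac F (m + n))%:C%C * fourier (partial m n).2 j.
  rewrite partial2S fourierD ?fourierZ ?fourier_mul_zpow//; exact: cbmeasM.
rewrite !E1 E2 big_ord_recr/=.
have [c0 _ _ _ _] := IHn 0.
have cpos j : 0 < j -> fourier (partial m n).1 j = 0 by case: (IHn j).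
have cneg j : j < - n%:Z -> fourier (partial m n).1 j = 0 by case: (IHn j).
have dlow j : j < m%:Z -> fourier (partial m n).2 j = 0 by case: (IHn j).
have dhigh j : (m + n)%:Z <= j -> fourier (partial m n).2 j = 0 by case: (IHn j).
split.
(* The mean receives from the second component only its coefficient of index [m + n], which lies
   just beyond its frequency range. So the mean is merely multiplied by [sfac F (m + n)]. *)
- by rewrite dhigh ?add0r// c0 mulr0 addr0 rmorphM/= mulrC.
- by move=> k0; rewrite cpos// dhigh ?mulr0 ?addr0//; lia.
- by move=> k0; rewrite cneg 1?dlow ?mulr0 ?addr0//; lia.
- by move=> k0; rewrite cneg 1?dlow ?mulr0 ?addr0//; lia.
- by move=> k0; rewrite cpos 1?dhigh ?mulr0 ?addr0//; lia.
Qed.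

Lemma abseq_inL n : inL (abseq F n).1 (abseq F n).2.
Proof.
rewrite abseq_partial; have [bc bd] := cbmeas_partial 0 n.+1.
split.
- exact: cbmeas_cmeasurable.
- exact: cbmeas_cmeasurable.
- apply: ae_muTW => t _; rewrite -!csqnorm_conj -rmorphD/=.
  by have := pnorm_partial 0 n.+1 t; rewrite /pnorm => ->.
- split; first exact: cbmeas_inL2.
  by move=> k k0; have [_ -> //] := fourier_partial 0 n.+1 k.
- rewrite at_infty_fourier; have [-> _ _ _ _] := fourier_partial 0 n.+1 0.
  by rewrite ltcR; apply: prodr_gt0 => i _; exact: sfac_gt0.
Qed.

(* Right multiplication by a matrix of SU(2) is an isometry, so the integrand is
   the squared norm of (c, d) - (1, 0), i.e. 2 - 2 Re c, with (c, d) = partial m n. *)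
Lemma int_csqnorm_diff m n :
  I (fun t => csqnorm ((partial 0 (m + n)).1 t - (partial 0 m).1 t) +
              csqnorm ((partial 0 (m + n)).2 t - (partial 0 m).2 t)) =
  2 - 2 * \prod_(i < n) sfac F (m + i).
Proof.
transitivity (I (fun t => 2 - 2 * complex.Re ((partial m n).1 t))).
  congr Rintegral; apply/funext => t.
  have := pnorm_partial 0 m t; have := pnorm_partial m n t.
  rewrite partial_cat add0n /pnorm/pmul/=.
  case: ((partial 0 m).1 t) ((partial 0 m).2 t) ((partial m n).1 t) ((partial m n).2 t)
    => [x1 y1] [x2 y2] [x3 y3] [x4 y4].
  rewrite /csqnorm/= => h1 h2.
  (* The difference equals (a_m, b_m)(c - 1, d), so its squared norm is a product; [x3] is Re c. *)
  transitivity ((x1 ^+ 2 + y1 ^+ 2 + (x2 ^+ 2 + y2 ^+ 2)) *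
    ((x3 ^+ 2 + y3 ^+ 2 + (x4 ^+ 2 + y4 ^+ 2)) + 1 - 2 * x3)); first by ring.
  by rewrite h1 h2; ring.
have [[bc _] _] := cbmeas_partial m n.
rewrite intB ?int_cst; [|exact: bmeas_cst|by apply: bmeasM => //; exact: bmeas_cst].
rewrite intZ//; congr (_ - _ * _).
have [] := fourier_partial m n 0.
by rewrite -at_infty_fourier => /(congr1 (@complex.Re R)).
Qed.

End PartialProducts.

(** * Passage to the limit for functions with coordinates in [-1, 1] *)

Section Convergence.
Variable R : realType.
Implicit Types (u v w : R -> R) (f g : R -> R[i]).

Notation I := (Rintegral (@muT R) (@Tdom R)).

Lemma squeeze0 (x y : nat -> R) : (forall n, 0 <= x n <= y n) ->
  y @ \oo --> 0 -> x @ \oo --> 0.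
Proof.
move=> xy y0; apply: (squeeze_cvgr _ (cvg_cst 0) y0).
exact: nearW.
Qed.

(** Cauchy-Schwarz on a space of mass one. It carries the L^2 estimate over to L^1, where
    [bounded_L1_complete] applies. *)
Lemma L1_le_L2 u (e : R) : bmeas u -> 0 < e -> I (fun t => u t ^+ 2) <= e ^+ 2 ->
  I (fun t => `|u t|) <= e.
Proof.
move=> bu e0 ue.
have b2 := bmeasX 2 bu.
have bz : bmeas (fun t => (2 * e)^-1 * u t ^+ 2) by apply: bmeasM => //; exact: bmeas_cst.
apply: (@le_trans _ _ (I (fun t => e / 2 + (2 * e)^-1 * u t ^+ 2))).
  apply: le_int; [exact: bmeas_norm|by apply: bmeasD => //; exact: bmeas_cst|move=> t].
  (* AM-GM: |u| <= e / 2 + u^2 / (2 e) *)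
  rewrite -subr_ge0.
  have -> : e / 2 + (2 * e)^-1 * u t ^+ 2 - `|u t| = (2 * e)^-1 * (`|u t| - e) ^+ 2.
    by rewrite sqrrB real_normK ?num_real//; field; rewrite gt_eqF.
  by rewrite mulr_ge0 ?sqr_ge0// invr_ge0 mulr_ge0// ltW.
rewrite intD ?int_cst; [|exact: bmeas_cst|exact: bz].
rewrite intZ//.
have : (2 * e)^-1 * I (fun t => u t ^+ 2) <= (2 * e)^-1 * e ^+ 2.
  by rewrite ler_wpM2l// invr_ge0 mulr_ge0// ltW.
have -> : (2 * e)^-1 * e ^+ 2 = e / 2 by field; rewrite gt_eqF.
lra.
Qed.

(** The two integrals differ by at most a bound of [w] times the L^1 distance. *)
Lemma int_mul_cvg (u : nat -> R -> R) v w : (forall n, bmeas (u n)) -> bmeas v -> bmeas w ->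
  I (fun t => `|u n t - v t|) @[n --> \oo] --> 0 ->
  I (fun t => u n t * w t) @[n --> \oo] --> I (fun t => v t * w t).
Proof.
move=> bu bv bw uv; have [_ [M wM]] := bw.
suff uv0 : `|I (fun t => u n t * w t) - I (fun t => v t * w t)| @[n --> \oo] --> (0 : R).
  by apply/subr_cvg0; apply: norm_cvg0; exact: uv0.
apply: (@squeeze0 _ (fun n => M * I (fun t => `|u n t - v t|))).
- move=> n; rewrite normr_ge0/=.
  have bd := bmeasB (bu n) bv.
  rewrite -intB; [|exact: bmeasM|exact: bmeasM].
  rewrite -intZ; last exact: bmeas_norm.
  rewrite (le_trans (le_norm_int _))//.
    by apply: bmeasB; exact: bmeasM.
  apply: le_int.
  + by apply: bmeas_norm; apply: bmeasB; exact: bmeasM.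
  + by apply: bmeasM; [exact: bmeas_cst|exact: bmeas_norm].
  + by move=> t; rewrite -mulrBl normrM mulrC ler_wpM2r.
- by rewrite -[X in _ --> X](mulr0 M); apply: cvgM => //; exact: cvg_cst.
Qed.

(** The coordinates are bounded rather than the modulus, since the limit is built one coordinate at
    a time. *)
Definition unit_bounded f := cmeasurable f /\
  forall t, `|complex.Re (f t)| <= 1 /\ `|complex.Im (f t)| <= 1.

(** For functions with coordinates in [-1, 1] this is equivalent to convergence in L^2, and it
    reduces to real functions. *)
Definition L1_cvg (f : nat -> R -> R[i]) g :=
  I (fun t => `|complex.Re (f n t) - complex.Re (g t)|) @[n --> \oo] --> 0 /\
  I (fun t => `|complex.Im (f n t) - complex.Im (g t)|) @[n --> \oo] --> 0.

Lemma unit_bounded_cbmeas f : unit_bounded f -> cbmeas f.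
Proof. by move=> [[mr mi] b]; split; split=> //; exists 1 => t; case: (b t). Qed.

Lemma csqnorm_le1_unit_bounded f : cmeasurable f -> (forall t, csqnorm (f t) <= 1) ->
  unit_bounded f.
Proof.
move=> mf f1; split=> // t; move: (f1 t); rewrite /csqnorm => h.
have := sqr_ge0 (complex.Re (f t)); have := sqr_ge0 (complex.Im (f t)) => hr hi.
by split; rewrite -[leRHS](sqrtr1) -sqrtr_sqr ler_wsqrtr//; lra.
Qed.

Lemma L2_cauchy_cvg (f : nat -> R -> R[i]) : (forall n, unit_bounded (f n)) ->
  (forall e : R, 0 < e -> exists N, forall m n, (N <= m)%N -> (m <= n)%N ->
    I (fun t => csqnorm (f n t - f m t)) <= e) ->
  exists2 g, unit_bounded g & L1_cvg f g.
Proof.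
move=> bf cau.
have cb n := unit_bounded_cbmeas (bf n).
(* A single argument then serves both coordinates. *)
pose comp (h : R[i] -> R) := (h = @complex.Re R) \/ (h = @complex.Im R).
have key h : comp h -> exists v, [/\ measurable_fun (@Tdom R) v, forall t, `|v t| <= 1 &
    I (fun t => `|h (f n t) - v t|) @[n --> \oo] --> 0].
  move=> ch.
  have bh n : bmeas (fun t => h (f n t)).
    by case: ch => ->; case: (cb n).
  apply: (@bounded_L1_complete R (fun n t => h (f n t))).
  - by move=> n; case: (bh n).
  - by move=> n t; case: ch => ->; case: (bf n) => _ /(_ t) [].
  (* The Cauchy condition bounds a squared norm, so it is invoked at [e ^+ 2] to obtain [e] in
     L^1. *)
  - move=> e e0; have [N NP] := cau _ (exprn_gt0 2 e0); exists N.
    have main m n : (N <= m)%N -> (m <= n)%N -> I (fun t => `|h (f n t) - h (f m t)|) <= e.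
      move=> Nm mn; apply: L1_le_L2 => //; first exact: bmeasB.
      apply: le_trans (NP m n Nm mn); apply: le_int.
      + by apply: bmeasX; exact: bmeasB.
      + exact: bmeas_csqnorm (cbmeasB (cb n) (cb m)).
      + move=> t; rewrite /csqnorm; case: ch => ->.
          by rewrite !raddfB lerDl sqr_ge0.
        by rewrite !raddfB lerDr sqr_ge0.
    move=> m n Nm Nn; case: (leqP m n) => mn; last exact: main (ltnW mn).
    by under eq_fun do rewrite distrC; exact: main.
have [x [mx x1 fx]] := key _ (or_introl erefl).
have [y [my y1 fy]] := key _ (or_intror erefl).
exists (fun t => (x t +i* y t)%C); first by split; [split|move=> t; split]; rewrite ?x1 ?y1.
by split.
Qed.

(** Each coordinate of a coefficient combines two integrals against a bounded cosine or sine, so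
    [int_mul_cvg] applies. *)
Lemma fourier_cvg (f : nat -> R -> R[i]) g k : (forall n, unit_bounded (f n)) ->
  unit_bounded g -> L1_cvg f g ->
  complex.Re (fourier (f n) k) @[n --> \oo] --> complex.Re (fourier g k) /\
  complex.Im (fourier (f n) k) @[n --> \oo] --> complex.Im (fourier g k).
Proof.
move=> bf bg [fgr fgi].
have cb n := unit_bounded_cbmeas (bf n).
have cg := unit_bounded_cbmeas bg.
have [zr zi] := @cbmeas_zpow R (- k).
have ReE h : cbmeas h -> complex.Re (fourier h k) =
    I (fun t => complex.Re (h t) * complex.Re (zpow (- k) t)) -
    I (fun t => complex.Im (h t) * complex.Im (zpow (- k) t)).
  move=> [hr hi]; rewrite -intB; [|exact: bmeasM|exact: bmeasM].
  by rewrite /fourier/cintT/=; congr Rintegral; apply/funext => t; rewrite complex_ReM.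
have ImE h : cbmeas h -> complex.Im (fourier h k) =
    I (fun t => complex.Re (h t) * complex.Im (zpow (- k) t)) +
    I (fun t => complex.Im (h t) * complex.Re (zpow (- k) t)).
  move=> [hr hi]; rewrite -intD; [|exact: bmeasM|exact: bmeasM].
  by rewrite /fourier/cintT/=; congr Rintegral; apply/funext => t; rewrite complex_ImM.
have cr n : bmeas (fun t => complex.Re (f n t)) by case: (cb n).
have ci n : bmeas (fun t => complex.Im (f n t)) by case: (cb n).
have [gr gi] := cg.
split.
  under eq_fun do rewrite (ReE _ (cb _)).
  by rewrite (ReE _ cg); apply: cvgB; exact: int_mul_cvg.
under eq_fun do rewrite (ImE _ (cb _)).
by rewrite (ImE _ cg); apply: cvgD; exact: int_mul_cvg.
Qed.

(** Serves twice: with [x] the partial products, for the mean, and with [x] constantly 0, for the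
    vanishing coefficients. *)
Lemma fourier_cvg_eq (f : nat -> R -> R[i]) g k (x : nat -> R) (l : R) :
  (forall n, unit_bounded (f n)) -> unit_bounded g -> L1_cvg f g ->
  (forall n, fourier (f n) k = (x n)%:C%C) -> x @ \oo --> l ->
  fourier g k = l%:C%C.
Proof.
move=> bf bg fg fx xl; have [cr ci] := fourier_cvg k bf bg fg.
rewrite (_ : (fun n => _) = x) in cr; last by apply/funext => n; rewrite fx.
rewrite (_ : (fun n => _) = fun=> 0) in ci; last by apply/funext => n; rewrite fx.
apply: complex_ext => /=; first exact: cvg_unique cr xl.
exact: cvg_unique ci (cvg_cst _).
Qed.

(** Upgrades L^1 convergence to quadratic quantities. The factor 2 comes from |x - y| <= 2 and |x +
    y| <= 2 on [-1, 1]. *)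
Lemma L1_cvg_dominated (f : nat -> R -> R[i]) g (h : nat -> R -> R) :
  (forall n, unit_bounded (f n)) -> unit_bounded g -> L1_cvg f g ->
  (forall n, bmeas (h n)) ->
  (forall n t, 0 <= h n t <= 2 * (`|complex.Re (f n t) - complex.Re (g t)| +
                                  `|complex.Im (f n t) - complex.Im (g t)|)) ->
  I (h n) @[n --> \oo] --> 0.
Proof.
move=> bf bg [fgr fgi] bh hfg.
have [gr gi] := unit_bounded_cbmeas bg.
apply: (@squeeze0 _
  (fun n => 2 * (I (fun t => `|complex.Re (f n t) - complex.Re (g t)|) +
                 I (fun t => `|complex.Im (f n t) - complex.Im (g t)|)))).
- move=> n; rewrite int_ge0/=; last by move=> t; have /andP[] := hfg n t.
  have [fr fi] := unit_bounded_cbmeas (bf n).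
  have br : bmeas (fun t => `|complex.Re (f n t) - complex.Re (g t)|).
    by apply: bmeas_norm; exact: bmeasB.
  have bi : bmeas (fun t => `|complex.Im (f n t) - complex.Im (g t)|).
    by apply: bmeas_norm; exact: bmeasB.
  rewrite -intD// -intZ; last exact: bmeasD.
  apply: le_int => //; first by apply: bmeasM; [exact: bmeas_cst|exact: bmeasD].
  by move=> t; have /andP[] := hfg n t.
- rewrite -[X in _ --> X](mulr0 2); apply: cvgM; first exact: cvg_cst.
  by rewrite -[X in _ --> X](addr0 0); exact: cvgD.
Qed.

Lemma L2norm_cvg (f : nat -> R -> R[i]) g : (forall n, unit_bounded (f n)) ->
  unit_bounded g -> L1_cvg f g -> L2norm (fun t => f n t - g t) @[n --> \oo] --> 0.
Proof.
move=> bf bg fg; rewrite -(@sqrtr0 R); apply: continuous_cvg; first exact: sqrt_continuous.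
apply: (L1_cvg_dominated bf bg fg) => [n|n t].
  exact: bmeas_csqnorm (cbmeasB (unit_bounded_cbmeas (bf n)) (unit_bounded_cbmeas bg)).
have sq (x y : R) : `|x| <= 1 -> `|y| <= 1 -> (x - y) ^+ 2 <= 2 * `|x - y|.
  move=> x1 y1; rewrite -real_normK ?num_real// expr2 ler_wpM2r//.
  by rewrite (le_trans (ler_normB _ _))//; lra.
have [_ /(_ t) [f1 f2]] := bf n; have [_ /(_ t) [g1 g2]] := bg.
by rewrite csqnorm_ge0 /csqnorm !raddfB mulrDr; apply: lerD; exact: sq.
Qed.

Lemma int_csqnorm_cvg (f : nat -> R -> R[i]) g : (forall n, unit_bounded (f n)) ->
  unit_bounded g -> L1_cvg f g ->
  I (fun t => `|csqnorm (f n t) - csqnorm (g t)|) @[n --> \oo] --> 0.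
Proof.
move=> bf bg fg; apply: (L1_cvg_dominated bf bg fg) => [n|n t].
  apply: bmeas_norm.
  exact: bmeasB (bmeas_csqnorm (unit_bounded_cbmeas (bf n)))
                (bmeas_csqnorm (unit_bounded_cbmeas bg)).
have sq (x y : R) : `|x| <= 1 -> `|y| <= 1 -> `|x ^+ 2 - y ^+ 2| <= 2 * `|x - y|.
  move=> x1 y1; rewrite subr_sqr normrM mulrC ler_wpM2r//.
  by rewrite (le_trans (ler_normD _ _))//; lra.
have [_ /(_ t) [f1 f2]] := bf n; have [_ /(_ t) [g1 g2]] := bg.
rewrite normr_ge0/= /csqnorm mulrDr opprD addrACA (le_trans (ler_normD _ _))//.
by apply: lerD; exact: sq.
Qed.

Lemma int_abs_eq0_ae u : bmeas u -> I (fun t => `|u t|) = 0 ->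
  {ae @muT R, forall t, @Tdom R t -> u t = 0}.
Proof.
move=> bu u0.
have mu : measurable_fun (@Tdom R) (EFin \o u) by apply/measurable_EFinP; case: bu.
have [+ _] := ae_eq_integral_abs (@lebesgue_measure R) (@measurable_Tdom R) mu.
have E : (\int[@muT R]_(t in @Tdom R) `|(EFin \o u) t|)%E = 0%E.
  by rewrite (integral_EFin (bmeas_norm bu)) u0.
move=> /(_ E); apply: ae_muTS => t h Tt.
by have := h Tt => -[].
Qed.

(** Writing 1 as the sum for [f n] and [f' n] bounds the integral of the absolute defect of the
    limit by two integrals that tend to 0. A nonnegative function of integral 0 vanishes almost
    everywhere. *)
Lemma csqnorm_sum_cvg (f f' : nat -> R -> R[i]) g g' :
  (forall n, unit_bounded (f n)) -> (forall n, unit_bounded (f' n)) ->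
  unit_bounded g -> unit_bounded g' -> L1_cvg f g -> L1_cvg f' g' ->
  (forall n t, csqnorm (f n t) + csqnorm (f' n t) = 1) ->
  {ae @muT R, forall t, @Tdom R t -> csqnorm (g t) + csqnorm (g' t) = 1}.
Proof.
move=> bf bf' bg bg' fg fg' ff'.
have cb n := bmeas_csqnorm (unit_bounded_cbmeas (bf n)).
have cb' n := bmeas_csqnorm (unit_bounded_cbmeas (bf' n)).
have cg := bmeas_csqnorm (unit_bounded_cbmeas bg).
have cg' := bmeas_csqnorm (unit_bounded_cbmeas bg').
have bu : bmeas (fun t => csqnorm (g t) + csqnorm (g' t) - 1).
  by apply: bmeasB; [exact: bmeasD|exact: bmeas_cst].
have : I (fun t => `|csqnorm (g t) + csqnorm (g' t) - 1|) = 0.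
  apply: le_anti; apply/andP; split; last exact: int_ge0.
  have c : I (fun t => `|csqnorm (f n t) - csqnorm (g t)|) +
      I (fun t => `|csqnorm (f' n t) - csqnorm (g' t)|) @[n --> \oo] --> (0 + 0 : R).
    by apply: cvgD; exact: int_csqnorm_cvg.
  rewrite -[leRHS](addr0 0); apply: (cvgr_to_ge c); apply: nearW => n.
  have bd : bmeas (fun t => `|csqnorm (f n t) - csqnorm (g t)|).
    by apply: bmeas_norm; exact: bmeasB.
  have bd' : bmeas (fun t => `|csqnorm (f' n t) - csqnorm (g' t)|).
    by apply: bmeas_norm; exact: bmeasB.
  rewrite -intD//; apply: le_int; [exact: bmeas_norm|exact: bmeasD|move=> t].
  rewrite -(ff' n t) distrC opprD addrACA; exact: ler_normD.
move=> /(int_abs_eq0_ae bu); apply: ae_muTS => t h Tt.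
by have /eqP := h Tt; rewrite subr_eq0 => /eqP.
Qed.

End Convergence.

(** * Positivity of the infinite product and the Cauchy estimate *)

Section InfiniteProduct.
Variables (R : realType) (F : int -> R[i]).
Implicit Types (m n : nat).

Notation I := (Rintegral (@muT R) (@Tdom R)).

Let P n : R := \prod_(i < n) sfac F i.

Lemma prod_sfac_gt0 n : 0 < P n.
Proof. by apply: prodr_gt0 => i _; exact: sfac_gt0. Qed.

Lemma prod_sfac_cat m n : P (m + n) = P m * \prod_(i < n) sfac F (m + i).
Proof. by rewrite /P big_split_ord. Qed.

Lemma prod_sfac_nincr : nonincreasing_seq P.
Proof.
apply/nonincreasing_seqP => n; rewrite /P big_ord_recr/= ler_piMr ?sfac_le1//.
exact: ltW (prod_sfac_gt0 n).
Qed.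

(** This is 1 + x <= e^x after a square root and an inversion. It converts square summability into a
    lower bound for the product. *)
Lemma expR_le_sfac n : expR (- (csqnorm (F n%:Z) / 2)) <= sfac F n.
Proof.
set x := csqnorm _.
have x0 : 0 <= x by exact: csqnorm_ge0.
have s0 : 0 < Num.sqrt (1 + x) by rewrite sqrtr_gt0 ltr_pwDl.
rewrite expRN /sfac lef_pV2 ?posrE ?expR_gt0//.
have -> : expR (x / 2) = Num.sqrt (expR x).
  by rewrite -[LHS](ger0_norm (expR_ge0 _)) -sqrtr_sqr expr2 -expRD -splitr.
by rewrite ler_wsqrtr// expR_ge1Dx.
Qed.

(** The partial products decrease and stay above e^(-l/2), so their limit exists and is positive. *)
Lemma prod_sfac_cvg (l : R) : series (fun n => csqnorm (F n%:Z)) @ \oo --> l ->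
  exists2 r : R, 0 < r & P @ \oo --> r.
Proof.
move=> sl.
have low n : expR (- (l / 2)) <= P n.
  have sn : series (fun n => csqnorm (F n%:Z)) n <= l.
    rewrite -(cvg_lim _ sl)//; apply: nondecreasing_cvgn_le; last by apply/cvg_ex; exists l.
    by apply/nondecreasing_seqP => k; rewrite seriesSr lerDl csqnorm_ge0.
  apply: (@le_trans _ _ (expR (- (series (fun n => csqnorm (F n%:Z)) n / 2)))).
    by rewrite ler_expR lerN2 ler_pM2r.
  elim: n {sn} => [|n IHn]; first by rewrite /series/= big_geq// mul0r oppr0 expR0 /P big_ord0.
  rewrite seriesSr mulrDl opprD expRD /P big_ord_recr/=.
  apply: ler_pM; [exact: expR_ge0|exact: expR_ge0|exact: IHn|exact: expR_le_sfac].
have cP : cvgn P.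
  apply: nonincreasing_is_cvgn; first exact: prod_sfac_nincr.
  by exists (expR (- (l / 2))) => _ [n _ <-].
exists (limn P); last exact: cP.
apply: lt_le_trans (expR_gt0 (- (l / 2))) _.
by apply: limr_ge => //; exact: nearW.
Qed.

(** The integral equals 2 - 2 Q, where Q is the ratio of two late partial products, hence close to 1
    because their limit is nonzero. *)
Lemma abseq_cauchy (r : R) : 0 < r -> P @ \oo --> r ->
  forall e : R, 0 < e -> exists N, forall m n, (N <= m)%N -> (m <= n)%N ->
    I (fun t => csqnorm ((abseq F n).1 t - (abseq F m).1 t) +
                csqnorm ((abseq F n).2 t - (abseq F m).2 t)) <= e.
Proof.
move=> r0 Pr e e0.
have rP n : r <= P n.
  rewrite -(cvg_lim _ Pr)//; apply: nonincreasing_cvgn_ge; first exact: prod_sfac_nincr.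
  by apply/cvg_ex; exists r.
(* This threshold yields [1 <= (1 + e / 2) * Q]. Together with [Q <= 1] it gives [Q >= 1 - e / 2],
   that is [2 - 2 * Q <= e]. *)
have re : r < r * (1 + e / 2) by rewrite ltr_pMr// ltrDl divr_gt0.
have [N _ NP] := cvgr_le _ Pr _ re; exists N => m n Nm mn.
rewrite !abseq_partial -(subnKC mn) -addSn int_csqnorm_diff.
have := prod_sfac_cat m.+1 (n - m); set Q := \prod_(i < n - m) _ => PQ.
have Pm : P m.+1 <= r * (1 + e / 2) by apply: NP => /=; lia.
have rQ : r <= P m.+1 * Q by rewrite -PQ.
have Q0 : 0 < Q by apply: prodr_gt0 => i _; exact: sfac_gt0.
have : r <= r * (1 + e / 2) * Q by apply: le_trans rQ _; rewrite ler_pM2r.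
rewrite -mulrA -[leLHS]mulr1 ler_pM2l// => h.
have Q1 : Q <= 1 by apply: prodr_ile1 => i _; rewrite sfac_le1 andbT ltW ?sfac_gt0.
have : e / 2 * Q <= e / 2 by rewrite ler_piMr// divr_ge0// ltW.
move: h; rewrite mulrDl mul1r; lra.
Qed.

End InfiniteProduct.

(** * The limit pair, its membership in the closure and its value at infinity *)

Theorem theorem6p2 (R : realType) (F : int -> R[i]) :
  (forall n : int, n < 0 -> F n = 0) ->
  (exists l : R, series (fun n : nat => csqnorm (F n%:Z)) @ \oo --> l) ->
  exists a b : R -> R[i],
    [/\ inHbar a b,
        (forall k : nat, inL (abseq F k).1 (abseq F k).2),
        (fun k : nat => rho (abseq F k).1 (abseq F k).2 a b) @ \oo --> 0 &
        exists r : R,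
          (fun N : nat => \prod_(n < N) sfac F n) @ \oo --> r /\ at_infty a = r%:C%C].
Proof.
move=> _ [l /prod_sfac_cvg [r r0 Pr]].
have cau := abseq_cauchy r0 Pr.
have [ba bb] : (forall n, unit_bounded (abseq F n).1) /\ (forall n, unit_bounded (abseq F n).2).
  split=> n; rewrite abseq_partial; have [c1 c2] := cbmeas_partial F 0 n.+1;
    apply: csqnorm_le1_unit_bounded; try exact: cbmeas_cmeasurable;
    by move=> t; have [] := csqnorm_partial F 0 n.+1 t.
have bd n m : bmeas (fun t => csqnorm ((abseq F n).1 t - (abseq F m).1 t)) /\
    bmeas (fun t => csqnorm ((abseq F n).2 t - (abseq F m).2 t)).
  by split; apply: bmeas_csqnorm; apply: cbmeasB; exact: unit_bounded_cbmeas.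
have [a ua fa] : exists2 a, unit_bounded a & L1_cvg (fun n => (abseq F n).1) a.
  apply: L2_cauchy_cvg => // e /cau [N NP]; exists N => m n Nm mn.
  apply: le_trans (NP m n Nm mn); have [b1 b2] := bd n m.
  by apply: le_int => //; [exact: bmeasD|move=> t; rewrite lerDl csqnorm_ge0].
have [b ub fb] : exists2 b, unit_bounded b & L1_cvg (fun n => (abseq F n).2) b.
  apply: L2_cauchy_cvg => // e /cau [N NP]; exists N => m n Nm mn.
  apply: le_trans (NP m n Nm mn); have [b1 b2] := bd n m.
  by apply: le_int => //; [exact: bmeasD|move=> t; rewrite lerDr csqnorm_ge0].
(* [abseq F n] has [n.+1] factors, so its mean is the partial product shifted by one, with the same
   limit. *)
have PrS : (fun n => \prod_(i < n.+1) sfac F i) @ \oo --> r 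
    by move: Pr; rewrite -cvg_shiftS.
have inftyE n : fourier (abseq F n).1 0 = (\prod_(i < n.+1) sfac F i)%:C%C.
  by rewrite abseq_partial; case: (fourier_partial F 0 n.+1 0).
have a_infty : at_infty a = r%:C%C.
  by rewrite at_infty_fourier; exact: fourier_cvg_eq ba ua fa inftyE PrS.
have zero f g k : (forall n, unit_bounded (f n)) -> unit_bounded g -> L1_cvg f g ->
    (forall n : nat, fourier (f n) k = 0) -> fourier g k = 0 :> R[i].
  by move=> uf ug fg f0; apply: (fourier_cvg_eq uf ug fg f0); exact: cvg_cst.
exists a, b; split.
- split; last first.
    split; first exact: cbmeas_inL2 (unit_bounded_cbmeas ub).
    (* Products that start at index 0 have no negative frequency in the second component. *)
    move=> k k0; apply: zero bb ub fb _ => n.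
    by rewrite abseq_partial; case: (fourier_partial F 0 n.+1 k) => _ _ _ ->.
  split; [by case: ua|by case: ub| | |by rewrite a_infty ltcR].
  + have : {ae @muT R, forall t, Tdom t -> csqnorm (a t) + csqnorm (b t) = 1}.
      apply: csqnorm_sum_cvg fa fb _ => // n t.
      by rewrite abseq_partial; exact: pnorm_partial.
    by apply: ae_muTS => t h /h h1; rewrite -!csqnorm_conj -rmorphD/= h1.
  + split; first exact: cbmeas_inL2 (unit_bounded_cbmeas ua).
    move=> k k0; apply: zero ba ua fa _ => n.
    by rewrite abseq_partial; case: (fourier_partial F 0 n.+1 k) => _ ->.
- exact: abseq_inL.
- rewrite /rho -[X in _ --> X](addr0 0) -[X in _ --> X + _](addr0 0).
  apply: cvgD; first by apply: cvgD; exact: L2norm_cvg.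
  (* The logarithmic term tends to 0 because [r] is positive, so that [ln] is continuous at [r]. *)
  rewrite -(normr0 R) -(subrr (ln r)); apply: cvg_norm.
  under eq_fun do rewrite a_infty at_infty_fourier inftyE.
  by apply: cvgB; [apply: continuous_cvg PrS; exact: continuous_ln|exact: cvg_cst].
- by exists r.
Qed.
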